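(* Fix $z_0\in\mathbb{C}$. Let $\tilde Y=(\tilde y_{ij})_{1\le i,j\le n}$ have i.i.d. entries with density $\rho(x)=e^{-x}/(1-n^{-10})$ for $x\in[0,10\log n]$ and $\rho(x)=0$ otherwise. Let $\tilde Y_{(n-1)\times n}$ be the $n\times n$ matrix obtained from $\tilde Y$ by replacing its first row with the zero vector, and let $F_{z_0}$ be the $n\times n$ deterministic matrix whose first row is $(-\sqrt n,\dots,-\sqrt n)$, whose first column is $(-\sqrt n,0,\dots,0)^T$, and whose lower-right $(n-1)\times(n-1)$ block is $z_0I_{n-1}$. Then for every constant $B>0$ there exists a constant $A>0$ such that \[ \mathbb{P}\Big(\sigma_n\Big(\tfrac{1}{\sqrt n}\tilde Y_{(n-1)\times n}-F_{z_0}\Big)\le n^{-A}\Big)=O(n^{-B}), \] where $\sigma_n(\cdot)$ denotes the smallest singular value of an $n\times n$ matrix. *)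

(* Defs.v *)
From HB Require Import structures.
From mathcomp Require Export all_boot all_order all_algebra.
From mathcomp Require Export complex spectral.
From mathcomp Require Export all_classical all_reals all_analysis.
Export Order.TTheory GRing.Theory Num.Theory.
Export numFieldNormedType.Exports.

Set Implicit Arguments.
Unset Strict Implicit.
Unset Printing Implicit Defensive.

Local Open Scope classical_set_scope.
Local Open Scope ring_scope.
Local Open Scope complex_scope.
Local Open Scope sesquilinear_scope.

Section singular_values.
Context {R : realType}.

Definition singular_values n (M : 'M[R[i]]_n) : set R :=
  [set s | 0 <= s /\ eigenvalue (M ^t* *m M) (s ^+ 2)%:C].

(* For n > 0 the set of singular values is finite and nonempty, so that this
   infimum is a minimum. *)
Definition smallest_singular_value n (M : 'M[R[i]]_n) : R :=
  inf (singular_values M).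

End singular_values.

Section random_variables.
Context d (T : measurableType d) (R : realType) (P : probability T R).

Definition has_density (X : {RV P >-> R}) (f : R -> R) : Prop :=
  forall A : set R, measurable A ->
    distribution P X A = (\int[lebesgue_measure]_(x in A) (f x)%:E)%E.

Definition mutually_independent (I : finType) (X : I -> {RV P >-> R}) : Prop :=
  forall (J : {set I}) (A : I -> set R),
    (forall i, i \in J -> measurable (A i)) ->
    P (\bigcap_(i in [set` J]) (X i @^-1` A i)) =
      (\prod_(i in J) P (X i @^-1` A i))%E.

End random_variables.

Section model.
Context {R : realType}.

(* Only meaningful for n >= 2, as 1 - n ^- 10 = 0 for n = 1. *)
Definition truncated_exp_density (n : nat) (x : R) : R :=
  if (0 <= x) && (x <= 10 * ln n%:R) then expR (- x) / (1 - n%:R ^- 10) else 0.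

Definition iid_entries d (T : measurableType d) (P : probability T R) n
    (Y : 'I_n -> 'I_n -> {RV P >-> R}) : Prop :=
  (forall i j, has_density (Y i j) (truncated_exp_density n)) /\
  mutually_independent (fun ij : 'I_n * 'I_n => Y ij.1 ij.2).

Definition random_matrix d (T : measurableType d) (P : probability T R) n
    (Y : 'I_n -> 'I_n -> {RV P >-> R}) (w : T) : 'M[R]_n :=
  \matrix_(i, j) Y i j w.

Definition zero_first_row n (M : 'M[R]_n) : 'M[R]_n :=
  \matrix_(i, j) if i == 0%N :> nat then 0 else M i j.

Definition F_mx n (z0 : R[i]) : 'M[R[i]]_n :=
  \matrix_(i, j)
    if i == 0%N :> nat then (- Num.sqrt n%:R)%:C
    else if j == 0%N :> nat then 0
    else if i == j then z0 else 0.

Definition shifted_mx n (z0 : R[i]) (M : 'M[R]_n) : 'M[R[i]]_n :=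
  map_mx (real_complex R) ((Num.sqrt n%:R)^-1 *: zero_first_row M) - F_mx n z0.

End model.

(* Main.v *)
(* Let S be the shifted matrix. For every entry (i, j) outside the first row,
   det S is affine in the entry, with slope the cofactor c_ij, and the remaining
   coefficients depend only on the other entries. Since the entries are
   independent with densities bounded by 2, |det S| < e |c_ij| has probability
   O(e sqrt n) unless c_ij = 0. The same estimate, applied to the matrices whose
   first m rows are those of S and whose other rows are those of the identity,
   shows row by row that det S is nonzero outside an event of comparable
   probability. As the first row of S is (sqrt n, ..., sqrt n), expanding det S
   along a column bounds the cofactors of the first row by the others. Hence,
   outside an event of small probability, all entries of the inverse
   adj S / det S are polynomially bounded, and so is the inverse of the smallest
   singular value. *)
Require Import Defs.
From mathcomp Require Import lra ring perm measurable_realfun.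

Set Implicit Arguments.
Unset Strict Implicit.
Unset Printing Implicit Defensive.

Local Open Scope classical_set_scope.
Local Open Scope ring_scope.

(** * Properties that hold outside a set of small probability *)

Section holds_up_to.
Context d (T : measurableType d) (R : realType) (P : probability T R).

(** Measurability is asked of the exceptional set only, so that union bounds apply to arbitrary
    properties [Q]. *)
Definition holds_up_to (c : R) (Q : T -> Prop) : Prop :=
  exists B, [/\ measurable B, (P B <= c%:E)%E & forall w, ~ B w -> Q w].

Lemma holds_up_to_imply c (Q Q' : T -> Prop) :
  (forall w, Q w -> Q' w) -> holds_up_to c Q -> holds_up_to c Q'.
Proof. by move=> QQ' [B [mB PB BQ]]; exists B; split => // w /BQ/QQ'. Qed.

Lemma holds_up_to_and c c' (Q Q' : T -> Prop) :
  holds_up_to c Q -> holds_up_to c' Q' ->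
  holds_up_to (c + c') (fun w => Q w /\ Q' w).
Proof.
move=> [B [mB PB BQ]] [B' [mB' PB' BQ']]; exists (B `|` B'); split.
- exact: measurableU.
- rewrite EFinD; apply: (le_trans (measureU2 _ mB mB')); exact: leeD.
- by move=> w nB; split; [apply: BQ | apply: BQ'] => ?; apply: nB; [left|right].
Qed.

Lemma holds_up_to_forall (I : finType) c (Q : I -> T -> Prop) :
  (forall i, holds_up_to c (Q i)) ->
  holds_up_to (#|I|%:R * c) (fun w => forall i, Q i w).
Proof.
move=> hQ.
suff h (s : seq I) : holds_up_to ((size s)%:R * c)
    (fun w => forall i, i \in s -> Q i w).
  rewrite cardE; apply: holds_up_to_imply (h (enum I)) => w hw i.
  by apply: hw; rewrite mem_enum.
elim: s => [|i s IH].
  by exists set0; split => //; rewrite measure0 mul0r.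
rewrite /= -natr1 mulrDl mul1r.
apply: holds_up_to_imply (holds_up_to_and IH (hQ i)) => w [hs hi] j.
by rewrite in_cons => /predU1P[->//|]; exact: hs.
Qed.

Lemma holds_up_to_le c (Q : T -> Prop) (E : set T) :
  measurable E -> holds_up_to c Q -> (forall w, Q w -> ~ E w) -> (P E <= c%:E)%E.
Proof.
move=> mE [B [mB PB BQ]] QE; apply: le_trans PB.
apply: le_measure; rewrite ?inE// => w Ew; apply: contrapT => /BQ/QE; exact.
Qed.

End holds_up_to.

(** * Independence of one variable from all the others, and small balls *)

Section independence.
Context d (T : measurableType d) (R : realType) (P : probability T R).
Context (I : finType) (X : I -> {RV P >-> R}).

(** Every index other than [k] carries a measurable set, possibly [setT], so these events form a
    pi-system; it generates the sigma-algebra of the other variables. *)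
Definition cylinders_off (k : I) : set (set T) :=
  [set E | exists A : I -> set R, (forall i, measurable (A i)) /\
     E = \bigcap_(i in [set i | i != k]) (X i @^-1` A i)].

Lemma cylinders_off_measurable k : cylinders_off k `<=` measurable.
Proof.
move=> _ [A [mA ->]]; apply: fin_bigcap_measurable => [|i _].
  exact: finite_finset.
by rewrite -[_ @^-1` _]setTI; exact: measurable_funPT.
Qed.

Lemma cylinders_offI k : setI_closed (cylinders_off k).
Proof.
move=> _ _ [A [mA ->]] [A' [mA' ->]].
exists (fun i => A i `&` A' i); split; first by move=> i; exact: measurableI.
by rewrite -bigcapI.
Qed.

Lemma cylinders_offT k : cylinders_off k setT.
Proof.
exists (fun=> setT); split => //.
by apply/esym; rewrite -subTset => x _ i _.
Qed.

Definition off_sigma (k : I) : set (set T) := <<s cylinders_off k >>.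

Lemma off_sigma_measurable k : off_sigma k `<=` measurable.
Proof.
apply: smallest_sub; first exact: sigma_algebra_measurable.
exact: cylinders_off_measurable.
Qed.

Lemma off_sigma_preimage k l (A : set R) : l != k -> measurable A ->
  off_sigma k (X l @^-1` A).
Proof.
move=> lk mA; apply: sub_sigma_algebra.
exists (fun i => if i == l then A else setT); split.
  by move=> i; case: ifP.
apply/seteqP; split => [x Ax i _ /=|x /(_ l lk)/=]; last by rewrite eqxx.
by case: ifP => // /eqP ->.
Qed.

Hypothesis indep : mutually_independent X.

(** In [E], both sides are finite measures: [P] restricted to an event, and a multiple of [P]. They
    agree on the pi-system of cylinders, hence on the sigma-algebra it generates. *)
Lemma independent_off k (A : set R) (E : set T) : measurable A -> off_sigma k E ->
  P (X k @^-1` A `&` E) = (P (X k @^-1` A) * P E)%E.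
Proof.
move=> mA kE.
have mXA : measurable (X k @^-1` A).
  by rewrite -[_ @^-1` _]setTI; exact: measurable_funPT.
have PAge0 : 0 <= fine (P (X k @^-1` A)) by rewrite fine_ge0.
have PAE : P (X k @^-1` A) = (fine (P (X k @^-1` A)))%:E.
  by rewrite fineK// fin_num_measure.
pose m1 := mrestr P mXA; pose m2 := mscale (NngNum PAge0) P.
have : m1 E = m2 E.
  apply: (@g_sigma_algebra_measure_unique _ _ _ (cylinders_off k) _ (fun=> setT)).
  - exact: cylinders_off_measurable.
  - by move=> _; exact: cylinders_offT.
  - by rewrite bigcup_const.
  - exact: cylinders_offI.
  - move=> _ [B [mB ->]].
    have m2E D : m2 D = (P (X k @^-1` A) * P D)%E by rewrite [in RHS]PAE.
    apply: etrans (esym (m2E _)); rewrite /m1 /mrestr.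
    (* Independence is used over all indices and over all but [k]; the two products differ by the
       factor at [k]. *)
    have := indep (J := [set: I]%SET) (A := fun i => if i == k then A else B i).
    have := indep (J := [set~ k]%SET) (A := B).
    move=> /(_ _)/wrap[] // h1 /(_ _)/wrap[].
      by move=> i _; case: ifP.
    rewrite (bigD1 k)//= eqxx => h2.
    transitivity (P (\bigcap_(i in [set` [set: I]%SET])
        (X i @^-1` (if i == k then A else B i)))).
      congr (P _); apply/seteqP; split.
        move=> x [/= h Ax] i _ /=.
        by case: ifPn => [/eqP ->//|/h].
      move=> x h; split.
        move=> i /= ik; have := h i; rewrite (negbTE ik); apply.
        by rewrite /= inE.
      by have := h k; rewrite eqxx; apply; rewrite /= inE.
    rewrite h2; congr (_ * _)%E.
    transitivity (P (\bigcap_(i in [set` [set~ k]%SET]) X i @^-1` B i)).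
      rewrite h1; apply: eq_big => [i|i]; first by rewrite !inE.
      by rewrite !inE => /negbTE ->.
    congr (P _); apply/seteqP.
    by split => x h i /= ik; apply: h; move: ik; rewrite /= !inE.
  - by move=> _; rewrite /m1/= ltey_eq fin_num_measure.
  - exact: kE.
by rewrite /m1 /m2 /mrestr /mscale/= -PAE setIC.
Qed.

(* Slicing [h] into cells of length [e], independence only has to be used for
   the events "[h] lies in a given cell", so that no joint law is needed. *)
Lemma small_ball_off k (h : T -> R) (e C : R) :
  0 < e -> @measurable_fun _ _ (g_sigma_algebraType (cylinders_off k)) R setT h ->
  (forall a, (P (X k @^-1` `[a, (a + 3 * e)%R]) <= C%:E)%E) ->
  holds_up_to P C (fun w => 0 <= X k w -> e < `|X k w - h w|).
Proof.
move=> e0 mh hC; exists [set w | 0 <= X k w /\ `|X k w - h w| <= e].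
(* If [h] lies in the cell [c m] and [X k] is within [e] of [h], then [X k] lies in the cell widened
   by [e] on both sides, of length [3 * e]; this is [b m]. *)
pose c (m : nat) : set T := h @^-1` `[(m%:R - 1) * e, m%:R * e[.
pose b (m : nat) : set T := X k @^-1` `[(m%:R - 2) * e, (m%:R - 2) * e + 3 * e].
have kc m : off_sigma k (c m).
  have := mh (@measurableT _ _) `[(m%:R - 1) * e, m%:R * e[%classic.
  by rewrite setTI; apply; exact: measurable_itv.
have mc m : measurable (c m) := off_sigma_measurable (kc m).
have mb m : measurable (b m).
  by rewrite -[b m]setTI; apply: measurable_funPT => //; exact: measurable_itv.
have mXh : measurable_fun setT (fun w => X k w - h w).
  apply: measurable_funB => //.
  by move=> _ B mB; apply: (@off_sigma_measurable k); exact: mh.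
have mE : measurable [set w | 0 <= X k w /\ `|X k w - h w| <= e].
  rewrite [X in measurable X](_ : _ = X k @^-1` `[0, +oo[ `&`
      (fun w => X k w - h w) @^-1` `[-e, e]).
    apply: measurableI; rewrite -[_ @^-1` _]setTI.
      by apply: measurable_funPT => //; exact: measurable_itv.
    by apply: mXh => //; exact: measurable_itv.
  apply/seteqP; split => w /=; rewrite !in_itv/= andbT ler_norml.
    by case=> -> ->.
  by case=> -> ->.
have tc : trivIset setT c.
  apply/trivIsetP => i j _ _.
  wlog: i j / (i < j)%N.
    move=> hw; rewrite neq_ltn => /orP[ij|ij]; first by apply: hw; rewrite ?ltn_eqF.
    by rewrite setIC; apply: hw; rewrite ?ltn_eqF.
  move=> ij _; rewrite -subset0 => w []; rewrite /c/= !in_itv/=.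
  move=> /andP[_ h1] /andP[h2 _]; have := le_lt_trans h2 h1.
  rewrite ltr_pM2r// ltrBlDr natr1 ltr_nat ltnS.
  by rewrite leqNgt ij.
have sub : [set w | 0 <= X k w /\ `|X k w - h w| <= e] `<=` \bigcup_m (b m `&` c m).
  move=> w [/= X0]; rewrite ler_distl => /andP[h1 h2].
  (* As [0 <= X k w <= h w + e], natural indices suffice: the cell of index 0 is the interval from
     [- e] to 0. *)
  have he : 0 <= (h w + e) / e by rewrite divr_ge0 ?(ltW e0)// (le_trans X0).
  exists (Num.truncn ((h w + e) / e)) => //.
  have /andP[t1 t2] := truncn_itv he.
  move: t1 t2; rewrite ler_pdivlMr// ltr_pdivrMr// -natr1.
  set m := (Num.truncn _)%:R => t1 t2.
  have t3 : (m - 1) * e <= h w by rewrite mulrBl mul1r lerBlDr.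
  have t4 : h w < m * e by move: t2; rewrite mulrDl mul1r ltrD2r.
  rewrite /b /c /=; split; rewrite in_itv/=; apply/andP; split => //; lra.
split; last by move=> w nB X0; rewrite ltNge; apply/negP => Xh; apply: nB.
  exact: mE.
apply: (@le_trans _ _ (\sum_(m <oo) P (b m `&` c m))%E).
  apply: measure_sigma_subadditive => //.
  by move=> m; exact: measurableI.
(* Independence splits each term, with [P (b m) <= C]; the disjoint cells [c m] have total
   probability at most 1. *)
apply: (@le_trans _ _ (\sum_(m <oo) C%:E * P (c m))%E).
  apply: lee_nneseries => // m _.
  rewrite (independent_off (measurable_itv _) (kc m)).
  by apply: lee_wpmul2r; [exact: measure_ge0 | exact: hC].
rewrite nneseriesZl//.
have C0 : 0 <= C.
  by rewrite -lee_fin; apply: le_trans (hC 0); exact: measure_ge0.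
rewrite -[leRHS]mule1; apply: lee_wpmul2l; first by rewrite lee_fin.
rewrite -measure_semi_bigcup//; last exact: bigcupT_measurable.
by apply: probability_le1; exact: bigcupT_measurable.
Qed.

End independence.

(** A new factor ['X - z%:P] adds the shifted coefficient to [- z] times the old one. The bound
    [0 <=] in all degrees serves the top degree, where the old coefficient vanishes. *)
Lemma coef_prod_XsubC_gt0 (D : numDomainType) (r : seq D) (k : nat) :
  (forall z, z \in r -> z < 0) ->
  0 <= (\prod_(z <- r) ('X - z%:P))`_k /\
  ((k <= size r)%N -> 0 < (\prod_(z <- r) ('X - z%:P))`_k).
Proof.
elim: r k => [|z r IH] k rneg.
  by rewrite big_nil coef1; case: k => //= k; rewrite lexx.
have {}IH k' := IH k' (fun y hy => rneg y (@mem_behead _ (z :: r) y hy)).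
have z0 : 0 < - z by rewrite oppr_gt0 rneg// mem_head.
rewrite big_cons mulrBl coefB coefXM coefCM -mulNr.
case: k => [|k] /=.
  by rewrite add0r pmulr_rge0// pmulr_rgt0//; split=> [|_]; apply IH.
split; first by rewrite addr_ge0 ?mulr_ge0 ?(ltW z0)//; apply IH.
rewrite ltnS => kr; rewrite ltr_wpDr//; last by apply IH.
by rewrite mulr_ge0 ?(ltW z0)//; apply IH.
Qed.

(** * Eigenvalues of Gram matrices and cofactors *)

Section hermitian_norm.
Local Open Scope sesquilinear_scope.
Context {C : numClosedFieldType}.
Implicit Types (n : nat).

Definition sqnorm n (v : 'rV[C]_n) : C := \sum_j `|v 0 j| ^+ 2.

Lemma sqnorm_ge0 n (v : 'rV[C]_n) : 0 <= sqnorm v.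
Proof. by apply: sumr_ge0 => j _; rewrite exprn_ge0. Qed.

Lemma sqnorm_gt0 n (v : 'rV[C]_n) : v != 0 -> 0 < sqnorm v.
Proof.
move=> v0; rewrite lt_def sqnorm_ge0 andbT; apply: contra v0.
rewrite psumr_eq0; last by move=> j _; rewrite exprn_ge0.
move=> /allP h; apply/eqP/rowP => j; rewrite mxE; apply/eqP.
by have := h j (mem_index_enum _); rewrite sqrf_eq0 normr_eq0.
Qed.

Lemma adjmxM m n p (A : 'M[C]_(m, n)) (B : 'M[C]_(n, p)) :
  (A *m B) ^t* = B ^t* *m A ^t*.
Proof. by rewrite trmx_mul map_mxM. Qed.

Lemma sqnormE n (v : 'rV[C]_n) : sqnorm v = (v *m v ^t*) 0 0.
Proof. by rewrite mxE; apply: eq_bigr => j _; rewrite !mxE normCK. Qed.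

Lemma gram_eigenvector n (M : 'M[C]_n) (a : C) (v : 'rV[C]_n) :
  v *m (M ^t* *m M) = a *: v -> sqnorm (v *m M ^t*) = a * sqnorm v.
Proof.
move=> h; rewrite !sqnormE adjmxM trmxCK mulmxA -[v *m _ *m M]mulmxA h.
by rewrite -scalemxAl mxE.
Qed.

(** With [u = v *m M ^t*], the adjugate recovers [v] from [u], so each [|v_k|] is at most [L] times
    the l1 norm of [u]. Bounding that norm by [n] times the l2 norm costs [n ^ 2] after squaring,
    and summing over [k] one more [n]; finally [sqnorm u = a * sqnorm v]. *)
Lemma sqnorm_gram_ge n (M : 'M[C]_n) (L a : C) (v : 'rV[C]_n) :
  0 <= L -> \det M != 0 ->
  (forall i j, `|cofactor M i j| <= L * `|\det M|) ->
  v != 0 -> v *m (M ^t* *m M) = a *: v -> 1 <= L ^+ 2 * n%:R ^+ 3 * a.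
Proof.
move=> L0 dM hL v0 hv.
have := gram_eigenvector hv; set u := v *m M ^t* => hu.
have hvu : \det M *: v ^t* = \adj M *m u ^t*.
  by rewrite /u adjmxM trmxCK mulmxA mul_adj_mx mul_scalar_mx.
have u0 := sqnorm_ge0 u.
have vk k : `|v 0 k| ^+ 2 <= L ^+ 2 * n%:R ^+ 2 * sqnorm u.
  have : `|\det M| * `|v 0 k| <= L * `|\det M| * \sum_j `|u 0 j|.
    have := congr1 (fun A : 'cV[C]_n => `|A k 0|) hvu.
    rewrite !mxE normrM norm_conjC => ->.
    apply: (le_trans (ler_norm_sum _ _ _)); rewrite mulr_sumr.
    apply: ler_sum => j _; rewrite !mxE normrM norm_conjC.
    by apply: ler_wpM2r => //; exact: hL.
  move=> h0; have h : `|v 0 k| <= L * \sum_j `|u 0 j|.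
    by rewrite -(@ler_pM2l _ `|\det M|) ?normr_gt0// mulrA [_ * L]mulrC.
  have : `|v 0 k| ^+ 2 <= (L * \sum_j `|u 0 j|) ^+ 2.
    by rewrite ler_pXn2r// nnegrE// (le_trans _ h).
  move=> /le_trans; apply.
  rewrite exprMn -[leRHS]mulrA; apply: ler_wpM2l; first by rewrite exprn_ge0.
  have le1 j : `|u 0 j| <= sqrtC (sqnorm u).
    rewrite -(@ler_pXn2r _ 2)// ?nnegrE// ?sqrtC_ge0// sqrtCK.
    by rewrite /sqnorm (bigD1 j)//= lerDl sumr_ge0// => i _; rewrite exprn_ge0.
  have : \sum_j `|u 0 j| <= n%:R * sqrtC (sqnorm u).
    apply: (@le_trans _ _ (\sum_(j < n) sqrtC (sqnorm u))); first exact: ler_sum.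
    by rewrite sumr_const card_ord mulr_natl.
  move=> h1; rewrite -[sqnorm u]sqrtCK -exprMn.
  by rewrite ler_pXn2r// nnegrE ?sumr_ge0// mulr_ge0// sqrtC_ge0.
have : sqnorm v <= L ^+ 2 * n%:R ^+ 3 * sqnorm u.
  apply: (@le_trans _ _ (\sum_(k < n) L ^+ 2 * n%:R ^+ 2 * sqnorm u)).
    exact: ler_sum.
  rewrite sumr_const card_ord -[leLHS]mulr_natl.
  by rewrite [leLHS](_ : _ = L ^+ 2 * n%:R ^+ 3 * sqnorm u)//; ring.
by rewrite hu mulrA -[X in X <= _]mul1r ler_pM2r ?sqnorm_gt0.
Qed.

End hermitian_norm.

(** * Singular values: existence, a polynomial criterion, a lower bound *)

Section least_singular_value.
Local Open Scope complex_scope.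
Local Open Scope sesquilinear_scope.
Context {R : realType}.

(** An eigenvalue is a quotient of two squared norms, hence real and non-negative, and has a real
    square root. *)
Lemma gram_eigenvalueE n (M : 'M[R[i]]_n) (a : R[i]) :
  eigenvalue (M ^t* *m M) a ->
  exists2 s, singular_values M s & a = (s ^+ 2)%:C.
Proof.
move=> ea; have /eigenvalueP[v hv v0] := ea.
have := gram_eigenvector hv; set u := sqnorm _ => hu.
have a0 : 0 <= a.
  by rewrite -(pmulr_lge0 _ (sqnorm_gt0 v0)) -hu sqnorm_ge0.
have aR : a = (complex.Re a)%:C by rewrite RRe_real// ger0_real.
have Ra0 : 0 <= complex.Re a by rewrite -ler0c -aR.
have aE : a = (Num.sqrt (complex.Re a) ^+ 2)%:C by rewrite (sqr_sqrtr Ra0) -aR.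
exists (Num.sqrt (complex.Re a)); last exact: aE.
by split; [exact: sqrtr_ge0 | rewrite -aE; exact: ea].
Qed.

Lemma singular_values_nonempty n (M : 'M[R[i]]_n) :
  (0 < n)%N -> singular_values M !=set0.
Proof.
move=> n0; have : size (char_poly (M ^t* *m M)) != 1%N.
  by rewrite size_char_poly eqSS -lt0n.
move=> /closed_rootP[a]; rewrite -eigenvalue_root_char.
by move=> /gram_eigenvalueE[s]; exists s.
Qed.

(* The roots [t ^ 2 - s ^ 2] of this polynomial are all real, so they are all
   negative as soon as all coefficients are positive. This condition only
   involves polynomial functions of the entries, and is thus measurable. *)
Lemma singular_values_gtP n (M : 'M[R[i]]_n) (t : R) : 0 <= t ->
  (forall s, singular_values M s -> t < s) <->
  (forall k : 'I_n.+1,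
     0 < (char_poly ((t ^+ 2)%:C%:M - M ^t* *m M))`_k).
Proof.
move=> t0; set N := _ - _; have pM := char_poly_monic N; split.
  move=> ht k; have [r] := closed_field_poly_normal (char_poly N).
  rewrite (monicP pM) scale1r => pE.
  have sr : size r = n.
    have := size_char_poly N.
    by rewrite pE size_prod_XsubC => -[].
  suff rneg z : z \in r -> z < 0.
    by rewrite pE; apply: (coef_prod_XsubC_gt0 k rneg).2; rewrite sr -ltnS.
  move=> zr.
  have : eigenvalue N z.
    by rewrite eigenvalue_root_char pE root_prod_XsubC.
  move=> /eigenvalueP[v hv v0].
  have : eigenvalue (M ^t* *m M) ((t ^+ 2)%:C - z).
    apply/eigenvalueP; exists v => //.
    have -> : M ^t* *m M = (t ^+ 2)%:C%:M - N by rewrite /N opprB addrC subrK.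
    by rewrite mulmxBr hv mul_mx_scalar scalerBl.
  move=> /gram_eigenvalueE[s Ms] sE; have ts := ht _ Ms.
  have -> : z = (t ^+ 2 - s ^+ 2)%:C by rewrite rmorphB/= -sE subKr.
  by rewrite -[0]/(0%:C) ltcR subr_lt0 ltr_pXn2r// nnegrE// (le_trans t0) ?ltW.
(* Conversely, [s <= t] would make [t ^ 2 - s ^ 2] a non-negative root of a polynomial with positive
   coefficients, whose value there is at least its constant term. *)
move=> hp s [s0 /eigenvalueP[v hv v0]]; rewrite ltNge; apply/negP => st.
have : root (char_poly N) (t ^+ 2 - s ^+ 2)%:C.
  rewrite -eigenvalue_root_char; apply/eigenvalueP; exists v => //.
  by rewrite /N mulmxBr hv mul_mx_scalar rmorphB/= scalerBl.
have x0 : 0 <= (t ^+ 2 - s ^+ 2)%:C.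
  by rewrite ler0c subr_ge0 ler_pXn2r// nnegrE.
rewrite /root horner_coef size_char_poly big_ord_recl/= expr0 mulr1.
rewrite gt_eqF// ltr_pwDl//; first exact: (hp ord0).
apply: sumr_ge0 => k _; rewrite mulr_ge0 ?exprn_ge0// ltW//.
exact: (hp (lift ord0 k)).
Qed.

Lemma singular_value_ge n (M : 'M[R[i]]_n) (L s : R) : 0 <= L ->
  \det M != 0 ->
  (forall i j, `|cofactor M i j| <= L%:C * `|\det M|) ->
  singular_values M s -> 1 <= L ^+ 2 * n%:R ^+ 3 * s ^+ 2.
Proof.
move=> L0 dM hL [s0 /eigenvalueP[v hv v0]].
have -> : L ^+ 2 * n%:R ^+ 3 * s ^+ 2 =
    complex.Re (L%:C ^+ 2 * n%:R ^+ 3 * (s ^+ 2)%:C).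
  by rewrite -(rmorph_nat (real_complex R)) -!rmorphXn -!rmorphM.
have := sqnorm_gram_ge _ dM hL v0 hv.
by rewrite ler0c lecE => /(_ L0) /andP[].
Qed.

Lemma smallest_singular_value_gt n (M : 'M[R[i]]_n) (L t : R) :
  (0 < n)%N -> 0 <= L -> 0 < t -> L ^+ 2 * n%:R ^+ 3 * t ^+ 2 < 1 / 4 ->
  \det M != 0 ->
  (forall i j, `|cofactor M i j| <= L%:C * `|\det M|) ->
  t < smallest_singular_value M.
Proof.
(* Bounds on all singular values pass to the infimum only weakly; the [1 / 4] in [ht] leaves room
   for [2 * t], whence strictness. *)
move=> n0 L0 t0 ht dM hL; apply: (@lt_le_trans _ _ (2 * t)); first by lra.
apply: lb_le_inf; first exact: singular_values_nonempty.
move=> s Ms; have := singular_value_ge L0 dM hL Ms.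
have [s0 _] := Ms; set K := L ^+ 2 * _ in ht * => h.
have K0 : 0 <= K by rewrite mulr_ge0 ?exprn_ge0.
rewrite leNgt; apply/negP => st.
have s2 : s ^+ 2 <= (2 * t) ^+ 2.
  by rewrite ler_pXn2r ?nnegrE//; lra.
have : K * s ^+ 2 <= K * (2 * t) ^+ 2 by apply: ler_wpM2l.
rewrite exprMn; nra.
Qed.

End least_singular_value.

(** * Classes of functions closed under determinants *)

Section determinant_closure.
Context (A : comNzRingType) (W : Type) (S : (W -> A) -> Prop).
Hypothesis S_cst : forall a, S (fun=> a).
Hypothesis S_add : forall f g, S f -> S g -> S (fun w => f w + g w).
Hypothesis S_mul : forall f g, S f -> S g -> S (fun w => f w * g w).

Lemma closed_sum (I : Type) (r : seq I) (Q : pred I) (F : I -> W -> A) :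
  (forall i, S (F i)) -> S (fun w => \sum_(i <- r | Q i) F i w).
Proof.
move=> SF; elim: r => [|i r IH].
  by rewrite (_ : (fun _ => _) = fun=> 0)//; apply/funext => w; rewrite big_nil.
case Qi : (Q i); last first.
  by rewrite (_ : (fun _ => _) = fun w => \sum_(j <- r | Q j) F j w)//;
    apply/funext => w; rewrite big_cons Qi.
rewrite (_ : (fun _ => _) = fun w => F i w + \sum_(j <- r | Q j) F j w).
  exact: S_add.
by apply/funext => w; rewrite big_cons Qi.
Qed.

Lemma closed_prod (I : Type) (r : seq I) (F : I -> W -> A) :
  (forall i, S (F i)) -> S (fun w => \prod_(i <- r) F i w).
Proof.
move=> SF; elim: r => [|i r IH].
  by rewrite (_ : (fun _ => _) = fun=> 1)//; apply/funext => w; rewrite big_nil.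
rewrite (_ : (fun _ => _) = fun w => F i w * \prod_(j <- r) F j w).
  exact: S_mul.
by apply/funext => w; rewrite big_cons.
Qed.

(** By the Leibniz formula. The class [S] is abstract because it is later instantiated over [R[i]]
    and over [{poly R[i]}]. *)
Lemma closed_det n (M : W -> 'M[A]_n) :
  (forall i j, S (fun w => M w i j)) -> S (fun w => \det (M w)).
Proof.
move=> SM; apply: (@closed_sum _ _ _
  (fun (s : {perm 'I_n}) w => (-1) ^+ s * \prod_i M w i (s i))) => s.
by apply: S_mul; [exact: S_cst | exact: closed_prod].
Qed.

End determinant_closure.

(** * Measurability of complex functions and of the smallest singular value *)

Section complex_measurable.
Local Open Scope complex_scope.
Local Open Scope sesquilinear_scope.
Context d (T : measurableType d) {R : realType}.
Implicit Types f g : T -> R[i].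

Definition cmeasurable f :=
  measurable_fun setT (fun w => complex.Re (f w)) /\
  measurable_fun setT (fun w => complex.Im (f w)).

Lemma cmeasurable_cst a : cmeasurable (fun=> a).
Proof. by split; exact: measurable_cst. Qed.

Lemma cmeasurable_real (f : T -> R) :
  measurable_fun setT f -> cmeasurable (fun w => (f w)%:C).
Proof. by move=> mf; split => //; exact: measurable_cst. Qed.

Lemma cmeasurableD f g :
  cmeasurable f -> cmeasurable g -> cmeasurable (fun w => f w + g w).
Proof.
move=> [f1 f2] [g1 g2]; split.
  rewrite (_ : (fun _ => _) =
    (fun w => complex.Re (f w)) \+ (fun w => complex.Re (g w))).
    exact: measurable_funD.
  by apply/funext => w /=; case: (f w); case: (g w).
rewrite (_ : (fun _ => _) =
  (fun w => complex.Im (f w)) \+ (fun w => complex.Im (g w))).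
  exact: measurable_funD.
by apply/funext => w /=; case: (f w); case: (g w).
Qed.

Lemma cmeasurableM f g :
  cmeasurable f -> cmeasurable g -> cmeasurable (fun w => f w * g w).
Proof.
move=> [f1 f2] [g1 g2]; split.
  rewrite (_ : (fun _ => _) =
    ((fun w => complex.Re (f w)) \* (fun w => complex.Re (g w))) \-
    ((fun w => complex.Im (f w)) \* (fun w => complex.Im (g w)))).
    by apply: measurable_funB; exact: measurable_funM.
  by apply/funext => w /=; case: (f w); case: (g w).
rewrite (_ : (fun _ => _) =
  ((fun w => complex.Re (f w)) \* (fun w => complex.Im (g w))) \+
  ((fun w => complex.Im (f w)) \* (fun w => complex.Re (g w)))).
  by apply: measurable_funD; exact: measurable_funM.
by apply/funext => w /=; case: (f w); case: (g w).
Qed.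

Lemma cmeasurableN f : cmeasurable f -> cmeasurable (fun w => - f w).
Proof.
move=> mf; rewrite (_ : (fun _ => _) = fun w => -1 * f w).
  by apply: cmeasurableM => //; exact: cmeasurable_cst.
by apply/funext => w; rewrite mulN1r.
Qed.

Lemma cmeasurable_conj f : cmeasurable f -> cmeasurable (fun w => (f w)^*%R).
Proof.
move=> [f1 f2]; split.
  rewrite (_ : (fun _ => _) = fun w => complex.Re (f w))//.
  by apply/funext => w /=; case: (f w).
rewrite (_ : (fun _ => _) = \- (fun w => complex.Im (f w))).
  exact: measurable_funN.
by apply/funext => w /=; case: (f w).
Qed.

Lemma cmeasurable_sum (I : Type) (r : seq I) (Q : pred I) (F : I -> T -> R[i]) :
  (forall i, cmeasurable (F i)) ->
  cmeasurable (fun w => \sum_(i <- r | Q i) F i w).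
Proof.
by apply: closed_sum; [exact: cmeasurable_cst | exact: cmeasurableD].
Qed.

Lemma cmeasurable_det n (M : T -> 'M[R[i]]_n) :
  (forall i j, cmeasurable (fun w => M w i j)) ->
  cmeasurable (fun w => \det (M w)).
Proof.
by apply: closed_det;
  [exact: cmeasurable_cst | exact: cmeasurableD | exact: cmeasurableM].
Qed.

(** The characteristic polynomial is a determinant over [{poly R[i]}], and the polynomials with
    measurable coefficients are closed under sums and products. *)
Lemma cmeasurable_char_poly n (M : T -> 'M[R[i]]_n) k :
  (forall i j, cmeasurable (fun w => M w i j)) ->
  cmeasurable (fun w => (char_poly (M w))`_k).
Proof.
move=> mM.
pose S (p : T -> {poly R[i]}) := forall k, cmeasurable (fun w => (p w)`_k).
suff : S (fun w => char_poly (M w)) by [].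
apply: closed_det.
- by move=> a l; exact: cmeasurable_cst.
- move=> f g Sf Sg l.
  under eq_fun do rewrite coefD; exact: cmeasurableD.
- move=> f g Sf Sg l; under eq_fun do rewrite coefM.
  by apply: cmeasurable_sum => i; exact: cmeasurableM.
- move=> i j l; under eq_fun do rewrite !mxE coefB coefC.
  apply: cmeasurableD; first exact: cmeasurable_cst.
  apply: cmeasurableN; case: (l == 0%N); [exact: mM | exact: cmeasurable_cst].
Qed.

Lemma measurable_cgt0 f : cmeasurable f -> measurable [set w | 0 < f w].
Proof.
move=> [f1 f2]; rewrite [X in measurable X](_ : _ =
    (fun w => complex.Im (f w)) @^-1` [set 0] `&`
    (fun w => complex.Re (f w)) @^-1` `]0, +oo[).
  apply: measurableI.
    by rewrite -[_ @^-1` _]setTI; apply: f2.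
  by rewrite -[_ @^-1` _]setTI; apply: f1 => //; exact: measurable_itv.
apply/seteqP; split => w /=; rewrite ltcE/= in_itv/= andbT.
  by move=> /andP[/eqP -> ->].
by move=> [-> ->]; rewrite eqxx.
Qed.

(** The sets [G u] are measurable by [singular_values_gtP]. The infimum is at most [t] exactly when,
    for each [k], some singular value is at most [t + 1 / (k + 1)]: a countable intersection of
    complements of such sets. *)
Lemma measurable_smallest_singular_value_le n (M : T -> 'M[R[i]]_n) (t : R) :
  (0 < n)%N -> 0 <= t -> (forall i j, cmeasurable (fun w => M w i j)) ->
  measurable [set w | smallest_singular_value (M w) <= t].
Proof.
move=> n0 t0 mM.
pose G (u : R) := [set w | forall s, singular_values (M w) s -> u < s].
have mG u : 0 <= u -> measurable (G u).
  move=> u0; pose N w := (u ^+ 2)%:C%:M - M w ^t* *m M w.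
  rewrite (_ : G u = \bigcap_(k in [set: 'I_n.+1])
      [set w | 0 < (char_poly (N w))`_k]); last first.
    apply/seteqP; split => w.
      by move=> /(singular_values_gtP _ u0) h k _; exact: h.
    by move=> h; apply/(singular_values_gtP _ u0) => k; exact: h.
  apply: fin_bigcap_measurable => [|k _]; first exact: finite_finset.
  apply: measurable_cgt0; apply: cmeasurable_char_poly => i j.
  under eq_fun do rewrite !mxE.
  apply: cmeasurableD; first exact: cmeasurable_cst.
  apply/cmeasurableN/cmeasurable_sum => l.
  under eq_fun do rewrite !mxE.
  by apply: cmeasurableM => //; apply: cmeasurable_conj; exact: mM.
rewrite [X in measurable X](_ : _ = \bigcap_(k in setT) ~` G (t + k.+1%:R^-1)).
  apply: bigcapT_measurable => k; apply: measurableC; apply: mG.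
  by rewrite addr_ge0.
have hlb w : has_lbound (singular_values (M w)) by exists 0 => s [].
apply/seteqP; split => w /=.
  move=> le k _ h.
  have : t + k.+1%:R^-1 <= smallest_singular_value (M w).
    apply: lb_le_inf; first exact: singular_values_nonempty.
    by move=> s /h /ltW.
  by apply/negP; rewrite -ltNge (le_lt_trans le)// ltrDl invr_gt0.
move=> h; apply/ler_addgt0Pl => e e0.
have [k /= ke] : exists k, k.+1%:R^-1 < e.
  have [k _ hk] := near_infty_natSinv_lt (PosNum e0).
  by exists k; exact: (hk k (leqnn k)).
have /existsNP[s /not_implyP[Ms /negP]] := h k I.
rewrite -leNgt => sk; apply: (@le_trans _ _ s); first exact: ge_inf.
by rewrite addrC (le_trans sk)// lerD2l ltW.
Qed.

End complex_measurable.

(** * The truncated exponential law *)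

Section density.
Context {R : realType}.

Lemma truncated_exp_density_ge0 n (x : R) :
  (2 <= n)%N -> 0 <= truncated_exp_density n x.
Proof.
move=> n2; rewrite /truncated_exp_density; case: ifP => // _.
rewrite divr_ge0 ?expR_ge0// subr_ge0 invf_le1 ?exprn_gt0 ?ltr0n ?(ltnW n2)//.
by rewrite exprn_ege1// ler1n ltnW.
Qed.

(** On the support the exponential is at most 1, and for [n >= 2] the denominator is at least
    [1 / 2]. *)
Lemma truncated_exp_density_le2 n (x : R) :
  (2 <= n)%N -> truncated_exp_density n x <= 2.
Proof.
move=> n2; rewrite /truncated_exp_density; case: ifP => // /andP[x0 _].
have h : n%:R ^- 10 <= 2^-1 :> R.
  rewrite lef_pV2 ?posrE ?exprn_gt0 ?ltr0n ?(ltnW n2)//.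
  apply: (@le_trans _ _ (n%:R ^+ 1)); first by rewrite expr1 ler_nat.
  by apply: ler_weXn2l => //; rewrite ler1n ltnW.
have e1 : expR (- x) <= 1 by rewrite -[leRHS]expR0 ler_expR oppr_le0.
rewrite ler_pdivrMr; lra.
Qed.

Lemma measurable_truncated_exp_density n (D : set R) :
  measurable_fun D (fun x : R => (truncated_exp_density n x)%:E).
Proof.
apply: measurable_funTS; apply/measurable_EFinP.
apply: measurable_fun_ifT => //.
  by apply: measurable_and; exact: measurable_fun_ler.
apply: measurable_funM => //.
by apply: measurableT_comp => //; exact: measurable_expR.
Qed.

Context d (T : measurableType d) (P : probability T R).
Context (X : {RV P >-> R}) (n : nat).
Hypotheses (n2 : (2 <= n)%N) (hX : has_density X (truncated_exp_density n)).

Lemma truncated_exp_itv (a b : R) : a <= b ->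
  (P (X @^-1` `[a, b]) <= (2 * (b - a))%:E)%E.
Proof.
move=> ab; have := hX (measurable_itv `[a, b]).
rewrite /distribution /pushforward => ->.
apply: (@le_trans _ _ (\int[lebesgue_measure]_(x in `[a, b]) cst 2%:E x)%E).
  apply: ge0_le_integral => //.
  - by move=> x _; rewrite lee_fin truncated_exp_density_ge0.
  - exact: measurable_truncated_exp_density.
  - by move=> x _; rewrite lee_fin truncated_exp_density_le2.
have L : lebesgue_measure (`[a, b] : set R) = (b - a)%:E.
  rewrite lebesgue_measure_itv/= lte_fin; case: ltP => // ba.
  by rewrite (@le_anti _ _ a b) ?ab// subrr.
rewrite integral_cst//; apply: (@le_trans _ _ (2%:E * (b - a)%:E)%E).
  by rewrite -L.
by rewrite -EFinM.
Qed.

Lemma truncated_exp_range :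
  holds_up_to P 0 (fun w => 0 <= X w <= 10 * ln n%:R).
Proof.
pose D : set R := ~` `[0, 10 * ln n%:R].
have mD : measurable D by apply: measurableC; exact: measurable_itv.
exists (X @^-1` D); split.
- by rewrite -[_ @^-1` _]setTI; exact: measurable_funPT.
- have := hX mD; rewrite /distribution /pushforward => ->.
  rewrite integral0_eq// => x; rewrite /D /= in_itv/= => /negP nx.
  by rewrite /truncated_exp_density (negbTE nx).
- by move=> w; rewrite /D /= in_itv/= => /contrapT.
Qed.

End density.

(** * The determinant as an affine function of one entry *)

Section replaced_entry.
Context (A : comNzRingType) (n : nat).

Lemma cofactor_eq_row (M N : 'M[A]_n) (i j : 'I_n) :
  (forall a b, a != i -> M a b = N a b) -> cofactor M i j = cofactor N i j.
Proof.
move=> MN; rewrite /cofactor; congr (_ * \det _).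
by apply/matrixP => a b; rewrite !mxE MN// eq_sym neq_lift.
Qed.

(** Cofactors of row [i] do not see that row, so the expansions of both determinants along it differ
    in one term. *)
Lemma det_replace_entry (M N : 'M[A]_n) (i j : 'I_n) :
  (forall a b, (a, b) != (i, j) -> M a b = N a b) ->
  \det M = \det N + (M i j - N i j) * cofactor N i j.
Proof.
move=> MN; rewrite (expand_det_row M i) (expand_det_row N i).
have cE b : cofactor M i b = cofactor N i b.
  apply: cofactor_eq_row => a c ai; apply: MN.
  by rewrite xpair_eqE (negbTE ai).
rewrite (bigD1 j)//= [in RHS](bigD1 j)//= cE mulrBl addrAC addrCA subrr addr0.
congr (_ + _); apply: eq_bigr => b bj; rewrite cE MN//.
by rewrite xpair_eqE (negbTE bj) andbF.
Qed.

End replaced_entry.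

(** * Anticoncentration of the determinant *)

Section anticoncentration.
Local Open Scope complex_scope.
Context d (T : measurableType d) (R : realType) (P : probability T R).
Context (n : nat) (X : 'I_n * 'I_n -> {RV P >-> R}).
Hypothesis indep : mutually_independent X.

Lemma cmeasurable_cofactor d' (T' : measurableType d') (M : T' -> 'M[R[i]]_n) i j :
  (forall a b, cmeasurable (fun w => M w a b)) ->
  cmeasurable (fun w => cofactor (M w) i j).
Proof.
move=> mM; apply: cmeasurableM; first exact: cmeasurable_cst.
by apply: cmeasurable_det => a b; under eq_fun do rewrite !mxE; exact: mM.
Qed.

(** Divide by [g] and take real parts. The fraction is the real part of [f / g], spelled out in real
    terms so that its measurability can be read off. *)
Lemma Re_divc_le (f g : R[i]) (x e : R) : g != 0 ->
  `|f + x%:C * g| <= e%:C * `|g| ->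
  `|x + (complex.Re f * complex.Re g + complex.Im f * complex.Im g) *
      (complex.Re g ^+ 2 + complex.Im g ^+ 2)^-1| <= e.
Proof.
move=> g0 h; have : `|f / g + x%:C| <= e%:C.
  rewrite -(@ler_pM2r _ `|g|) ?normr_gt0// -normrM mulrDl divfK//.
rewrite -lecR; apply: le_trans; apply: le_trans (normc_ge_Re _).
rewrite lecR le_eqVlt; apply/orP; left; apply/eqP; congr `|_|.
case: f g {h g0} => [f1 f2] [g1 g2] /=; set v := (_ + _)^-1; ring.
Qed.

(** Let [N] be [M] with the entry replaced by its constant part [z]. Then [det M = f + r * X * g]
    with [f = det N] and [g] the cofactor. If [|det M| <= e * |g|], then [X] is within [e / r] of
    [h = - Re (f / g) / r], which depends on the other entries only. *)
Lemma det_anticoncentration (M : T -> 'M[R[i]]_n) (i j : 'I_n)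
    (r e c : R) (z : R[i]) :
  0 < r -> 0 < e ->
  (forall a, (P (X (i, j) @^-1` `[a, (a + 3 * (e / r))%R]) <= c%:E)%E) ->
  (forall w, M w i j = (r * X (i, j) w)%:C + z) ->
  (forall a b, (a, b) != (i, j) ->
    cmeasurable (T := g_sigma_algebraType (cylinders_off X (i, j)))
      (fun w => M w a b)) ->
  holds_up_to P c (fun w => 0 <= X (i, j) w -> cofactor (M w) i j != 0 ->
    e%:C * `|cofactor (M w) i j| < `|\det (M w)|).
Proof.
move=> r0 e0 hc ME mM.
pose N w := \matrix_(a, b) if (a, b) == (i, j) then z else M w a b.
have mN a b : cmeasurable (T := g_sigma_algebraType (cylinders_off X (i, j)))
    (fun w => N w a b).
  under eq_fun do rewrite mxE.
  by case: eqVneq => [_|ab]; [exact: cmeasurable_cst | exact: mM].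
pose f w := \det (N w); pose g w := cofactor (N w) i j.
have [f1 f2] := cmeasurable_det mN; have [g1 g2] := cmeasurable_cofactor i j mN.
pose nm w := complex.Re (g w) ^+ 2 + complex.Im (g w) ^+ 2.
(* [expR (- ln x)] is the inverse of [x] whenever [0 < x]. *)
pose h w := - (r^-1 * ((complex.Re (f w) * complex.Re (g w) +
  complex.Im (f w) * complex.Im (g w)) * expR (- ln (nm w)))).
have mh : @measurable_fun _ _
    (g_sigma_algebraType (cylinders_off X (i, j))) R setT h.
  apply: measurable_funN; apply: measurable_funM => //.
  apply: measurable_funM.
    by apply: measurable_funD; exact: measurable_funM.
  apply: measurableT_comp; first exact: measurable_expR.
  apply: measurable_funN; apply: measurableT_comp; first exact: measurable_ln.
  by apply: measurable_funD; exact: measurable_funX.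
apply: holds_up_to_imply (small_ball_off indep (divr_gt0 e0 r0) mh hc).
move=> w hw X0; move: hw => /(_ X0) hw.
have MN a b : (a, b) != (i, j) -> M w a b = N w a b.
  by move=> /negbTE ab; rewrite mxE ab.
have -> : cofactor (M w) i j = g w.
  apply: cofactor_eq_row => a b ai; apply: MN.
  by rewrite xpair_eqE (negbTE ai).
rewrite (det_replace_entry MN) ME mxE eqxx addrK => g0.
rewrite real_ltNge ?normr_real//; last first.
  by rewrite ger0_real// mulr_ge0// ler0c ltW.
apply/negP => /(Re_divc_le g0); apply/negP; rewrite -ltNge.
have nm0 : 0 < nm w.
  by rewrite -ltcR [X in _ < X]add_Re2_Im2 exprn_gt0// normr_gt0.
move: hw; rewrite /h expRN lnK ?posrE// opprK ltr_pdivrMr//.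
set q := _ / nm w; rewrite -[X in _ * X](gtr0_norm r0) -normrM.
congr (_ < `|_|); field; by rewrite gt_eqF.
Qed.

End anticoncentration.

(** * Nonvanishing of the determinant, row by row *)

Section partial_matrix.
Context (F : fieldType) (n : nat).
Implicit Types M : 'M[F]_n.

(** Its determinant is the leading principal minor of order [m], without a change of matrix size. *)
Definition partial_mx M (m : nat) : 'M[F]_n :=
  \matrix_(a, b) if (a < m)%N then M a b else (a == b)%:R.

Lemma partial_mx_full M : partial_mx M n = M.
Proof. by apply/matrixP => a b; rewrite mxE ltn_ord. Qed.

(** Row [k] of [partial_mx M k] is a unit vector, and the two matrices agree in all other rows. *)
Lemma cofactor_partial_mx M (k : 'I_n) :
  cofactor (partial_mx M k.+1) k k = \det (partial_mx M k).
Proof.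
rewrite (expand_det_row _ k) (bigD1 k)//= big1 => [|b bk]; last first.
  by rewrite mxE ltnn eq_sym (negbTE bk) mul0r.
rewrite addr0 mxE ltnn eqxx mul1r.
apply: cofactor_eq_row => a b ak; rewrite !mxE ltnS leq_eqVlt.
by rewrite (negbTE (ak : (a : nat) != k)).
Qed.

(** Induction on [m] from the identity matrix: each determinant is the cofactor whose nonvanishing
    [h] asks for at the next row. *)
Lemma det_neq0_partial M (i0 : 'I_n) : i0 = 0%N :> nat -> M i0 i0 != 0 ->
  (forall k : 'I_n, k != i0 -> cofactor (partial_mx M k.+1) k k != 0 ->
     \det (partial_mx M k.+1) != 0) ->
  \det M != 0.
Proof.
move=> i00 M00 h; rewrite -[M]partial_mx_full.
suff: forall m, (m <= n)%N -> \det (partial_mx M m) != 0 by apply.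
elim=> [_|m IH mn].
  rewrite (_ : partial_mx M 0 = 1%:M) ?det1 ?oner_eq0//.
  by apply/matrixP => a b; rewrite !mxE.
have {}IH := IH (ltnW mn); pose k := Ordinal mn.
have [ki|ki] := eqVneq k i0; last first.
  by apply: (h k ki); rewrite cofactor_partial_mx.
have m0 : m = 0%N by rewrite -i00 -ki.
(* Here [m = 0]: below the first row the matrix is the identity, so its first column has only the
   entry [M i0 i0]. *)
rewrite (expand_det_col _ k) (bigD1 k)//= big1 => [|a ak]; last first.
  rewrite mxE ltnS leqNgt m0 lt0n; have -> : a != 0%N :> nat.
    by apply: contra ak => /eqP a0; apply/eqP/val_inj; rewrite /= a0 m0.
  by rewrite /= (negbTE ak) mul0r.
rewrite addr0 (cofactor_partial_mx M k) mulf_neq0// mxE ltnS leqnn.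
by rewrite ki.
Qed.

End partial_matrix.

(** * Bounding the cofactors of the constant row by the others *)

Section cofactor_bound.
Context (C : numFieldType) (n : nat).

(** Rows other than [i0] account for [e^-1]. In row [i0], expansion along column [j] isolates [s]
    times the cofactor, and [1 <= s] leaves [1 + n * (K / e)]. *)
Lemma cofactor_le (M : 'M[C]_n) (i0 : 'I_n) (e K s : C) :
  0 < e -> 1 <= s -> 0 <= K ->
  (forall j, M i0 j = s) ->
  (forall i j, i != i0 -> `|M i j| <= K) ->
  (forall i j, i != i0 -> e * `|cofactor M i j| <= `|\det M|) ->
  forall i j, `|cofactor M i j| <= (e^-1 + 1 + n%:R * (K / e)) * `|\det M|.
Proof.
move=> e0 s1 K0 Ms MK he.
have ei : 0 <= e^-1 by rewrite invr_ge0 ltW.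
have s0 : 0 <= s by rewrite (le_trans ler01).
have he' i j : i != i0 -> `|cofactor M i j| <= e^-1 * `|\det M|.
  by move=> /(he i j); rewrite mulrC ler_pdivlMl// mulrC.
have nK : 0 <= n%:R * (K / e) by rewrite !mulr_ge0.
move=> i j; have [->|ii] := eqVneq i i0; last first.
  apply: (le_trans (he' i j ii)); apply: ler_wpM2r => //.
  by rewrite -addrA lerDl addr_ge0.
have dE : s * cofactor M i0 j =
    \det M - \sum_(i | i != i0) M i j * cofactor M i j.
  by rewrite (expand_det_col _ j) (bigD1 i0)//= addrK Ms.
apply: (@le_trans _ _ `|s * cofactor M i0 j|).
  by rewrite [leRHS]normrM (ger0_norm s0) ler_peMl.
rewrite dE; apply: (le_trans (ler_normB _ _)).
have : `|\sum_(i | i != i0) M i j * cofactor M i j| <=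
    n%:R * (K / e) * `|\det M|.
  apply: (le_trans (ler_norm_sum _ _ _)).
  apply: (@le_trans _ _ (\sum_(i < n | i != i0) K / e * `|\det M|)).
    apply: ler_sum => a ai; rewrite normrM -mulrA.
    by apply: ler_pM => //; [exact: MK | exact: he'].
  apply: (@le_trans _ _ (\sum_(i < n) K / e * `|\det M|)).
    rewrite [leRHS](bigID (fun a => a != i0))/= lerDl sumr_ge0// => a _.
    by rewrite !mulr_ge0.
  by rewrite sumr_const card_ord -[leLHS]mulr_natl mulrA.
move=> h; rewrite !mulrDl mul1r -addrA; apply: (@le_trans _ _
  (`|\det M| + n%:R * (K / e) * `|\det M|)); first by rewrite lerD2l.
by rewrite lerDr mulr_ge0.
Qed.

End cofactor_bound.

(** * Entries of the shifted matrix *)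

Section shifted_matrix.
Local Open Scope complex_scope.
Context {R : realType} (n : nat) (z0 : R[i]).

Lemma shifted_mx_row0 (M : 'M[R]_n) (i j : 'I_n) : i = 0%N :> nat ->
  shifted_mx z0 M i j = (Num.sqrt n%:R)%:C.
Proof. by move=> i0; rewrite !mxE i0/= mulr0 sub0r rmorphN opprK. Qed.

Definition shift_entry (i j : 'I_n) : R[i] :=
  if j == 0%N :> nat then 0 else if i == j then z0 else 0.

Lemma shifted_mx_row (M : 'M[R]_n) (i j : 'I_n) : i != 0%N :> nat ->
  shifted_mx z0 M i j = ((Num.sqrt n%:R)^-1 * M i j)%:C - shift_entry i j.
Proof. by move=> /negbTE i0; rewrite !mxE i0. Qed.

Lemma shift_entry_le (i j : 'I_n) : `|shift_entry i j| <= `|z0|.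
Proof.
by rewrite /shift_entry; case: eqP => _; [|case: eqP => _]; rewrite ?normr0.
Qed.

End shifted_matrix.

(** * The event on which all estimates hold *)

Section good_event.
Local Open Scope complex_scope.
Context d (T : measurableType d) (R : realType) (P : probability T R) (n : nat).
Context (Y : 'I_n -> 'I_n -> {RV P >-> R}) (z0 : R[i]).
Hypotheses (n2 : (2 <= n)%N) (iid : iid_entries Y).

Let X (ij : 'I_n * 'I_n) := Y ij.1 ij.2.
Let S w := shifted_mx z0 (random_matrix Y w).
Let r : R := (Num.sqrt n%:R)^-1.

Lemma random_matrix_off_measurable (k : 'I_n * 'I_n) a b : (a, b) != k ->
  cmeasurable (T := g_sigma_algebraType (cylinders_off X k)) (fun w => S w a b).
Proof.
move=> abk; have [a0|a0] := eqVneq (a : nat) 0%N.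
  by under eq_fun do rewrite /S shifted_mx_row0//; exact: cmeasurable_cst.
under eq_fun do rewrite /S shifted_mx_row// mxE.
apply: cmeasurableD; last exact: cmeasurable_cst.
apply: cmeasurable_real; apply: measurable_funM => // _ A mA.
by rewrite setTI; apply: (off_sigma_preimage (l := (a, b))).
Qed.

Lemma random_matrix_measurable a b : cmeasurable (fun w => S w a b).
Proof.
have [a0|a0] := eqVneq (a : nat) 0%N.
  by under eq_fun do rewrite /S shifted_mx_row0//; exact: cmeasurable_cst.
under eq_fun do rewrite /S shifted_mx_row// mxE.
apply: cmeasurableD; last exact: cmeasurable_cst.
by apply: cmeasurable_real; exact: measurable_funM.
Qed.

(** Entries may be random or constant so as to cover both [S] and its [partial_mx]. The 6 is the
    density bound 2 times the length factor 3. *)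
Lemma shifted_anticoncentration (M : T -> 'M[R[i]]_n) (i j : 'I_n) (e : R) :
  0 < e -> i != 0%N :> nat -> (forall w, M w i j = S w i j) ->
  (forall a b, (forall w, M w a b = S w a b) \/ exists z, forall w, M w a b = z) ->
  holds_up_to P (6 * (e / r)) (fun w => 0 <= Y i j w -> cofactor (M w) i j != 0 ->
    e%:C * `|cofactor (M w) i j| < `|\det (M w)|).
Proof.
move=> e0 i0 Mij Mab.
have r0 : 0 < r by rewrite invr_gt0 sqrtr_gt0 ltr0n ltnW.
apply: (@det_anticoncentration _ _ _ _ _ X iid.2 M i j r e _
  (- shift_entry z0 i j)) => //.
- move=> a; apply: (le_trans (truncated_exp_itv n2 (iid.1 i j) _)).
    by rewrite lerDl mulr_ge0// divr_ge0 ?ltW.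
  by rewrite lee_fin; lra.
- by move=> w; rewrite Mij /S shifted_mx_row// mxE.
- move=> a b ab; case: (Mab a b) => [h|[z h]].
    under eq_fun do rewrite h; exact: random_matrix_off_measurable.
  under eq_fun do rewrite h; exact: cmeasurable_cst.
Qed.

(** A union bound: the support condition costs 0, the cofactors cost [c] for each of [n ^ 2]
    entries, and the partial matrices [c] for each of [n] rows. *)
Lemma good_event (e : R) : 0 < e ->
  holds_up_to P (6 * (e / r) * (n%:R ^+ 2 + n%:R)) (fun w =>
    [/\ forall i j, 0 <= Y i j w <= 10 * ln n%:R,
        forall i j : 'I_n, i != 0%N :> nat ->
          e%:C * `|cofactor (S w) i j| <= `|\det (S w)| &
        \det (S w) != 0]).
Proof.
move=> e0; set c := 6 * (e / r).
have r0 : 0 < r by rewrite invr_gt0 sqrtr_gt0 ltr0n ltnW.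
have c0 : 0 <= c by rewrite mulr_ge0// divr_ge0 ?ltW.
have h1 := holds_up_to_forall (fun ij : 'I_n * 'I_n =>
  truncated_exp_range (iid.1 ij.1 ij.2)).
have h2 : holds_up_to P (n%:R ^+ 2 * c) (fun w => forall ij : 'I_n * 'I_n,
    0 <= Y ij.1 ij.2 w -> ij.1 != 0%N :> nat ->
    cofactor (S w) ij.1 ij.2 != 0 ->
    e%:C * `|cofactor (S w) ij.1 ij.2| < `|\det (S w)|).
  rewrite -natrX -[(n ^ 2)%N]/(n * n)%N -{1 2}(card_ord n) -card_prod.
  apply: holds_up_to_forall => -[i j] /=.
  have [i0|i0] := eqVneq (i : nat) 0%N.
    by exists set0; split => //; rewrite measure0.
  have := shifted_anticoncentration (M := S) (j := j) e0 i0 (fun=> erefl)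
    (fun a b => or_introl (fun=> erefl)).
  by apply: holds_up_to_imply => w hw Y0 _; exact: hw.
have h3 : holds_up_to P (n%:R * c) (fun w => forall k : 'I_n,
    0 <= Y k k w -> k != 0%N :> nat ->
    cofactor (partial_mx (S w) k.+1) k k != 0 ->
    \det (partial_mx (S w) k.+1) != 0).
  rewrite -{1}(card_ord n); apply: holds_up_to_forall => k.
  have [k0|k0] := eqVneq (k : nat) 0%N.
    by exists set0; split => //; rewrite measure0.
  have := shifted_anticoncentration (M := fun w => partial_mx (S w) k.+1)
    (i := k) (j := k) e0 k0.
  move=> /(_ _ _)/wrap[].
  - by move=> w; rewrite mxE ltnSn.
  - move=> a b; have [ak|ak] := boolP (a < k.+1)%N.
      by left => w; rewrite mxE ak.
    by right; exists (a == b)%:R => w; rewrite mxE (negbTE ak).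
  apply: holds_up_to_imply => w hw Y0 _ cof0.
  rewrite -normr_gt0; apply: le_lt_trans (hw Y0 cof0).
  by rewrite mulr_ge0// ler0c ltW.
have -> : c * (n%:R ^+ 2 + n%:R) =
    #|{: 'I_n * 'I_n}|%:R * 0 + (n%:R ^+ 2 * c + n%:R * c) by ring.
apply: holds_up_to_imply (holds_up_to_and h1 (holds_up_to_and h2 h3)).
move=> w [range [hcof hpart]].
have Y0 i j : 0 <= Y i j w by have /andP[] := range (i, j).
split.
- by move=> i j; exact: (range (i, j)).
- move=> i j i0; have [->|cof0] := eqVneq (cofactor (S w) i j) 0.
    by rewrite normr0 mulr0.
  by apply: ltW; apply: (hcof (i, j)).
(* The induction over rows starts from the corner entry, which is [sqrt n]. *)
- have n0 : (0 < n)%N by exact: ltnW.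
  apply: (@det_neq0_partial _ _ _ (Ordinal n0)) => //.
    rewrite /S shifted_mx_row0// -[0]/(0%:C) (inj_eq (@complexI R)).
    by rewrite gt_eqF// sqrtr_gt0 ltr0n.
  by move=> k k0; apply: hpart.
Qed.

End good_event.

(** * Choice of exponents and conclusion *)

Section conclusion.
Local Open Scope complex_scope.
Context {R : realType} (n : nat) (z0 : R[i]).
Hypotheses (n2 : (2 <= n)%N) (nz0 : 10 + complex.Re `|z0| <= n%:R).

(** With [e = n ^- (m + 3)] and entries below the first row at most [K <= n ^ 2], all cofactors are
    at most [n ^ (m + 3) * (2 + n ^ 3) <= n ^ (m + 7)] times [|det S|]. *)
Lemma smallest_singular_value_shifted_gt (M : 'M[R]_n) (m : nat) :
  let S := shifted_mx z0 M in
  (forall i j, 0 <= M i j <= 10 * ln n%:R) ->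
  (forall i j : 'I_n, i != 0%N :> nat ->
     (n%:R ^- m.+3)%:C * `|cofactor S i j| <= `|\det S|) ->
  \det S != 0 ->
  n%:R ^- (m + 10) < smallest_singular_value S.
Proof.
move=> S hM hcof dS; pose N : R := n%:R; pose Z := complex.Re `|z0|.
have nZ : 10 + Z <= N := nz0.
have N2 : 2 <= N by rewrite ler_nat.
have N0 : 0 < N by lra.
have ZE : `|z0| = Z%:C by rewrite RRe_real// normr_real.
have Z0 : 0 <= Z by rewrite -ler0c -ZE.
have Q0 : 0 < N ^+ m.+3 by rewrite exprn_gt0.
have lnN : 0 <= ln N by rewrite ln_ge0//; lra.
have lnle : ln N <= N by rewrite ltW// ln_sublinear.
have s1 : 1 <= Num.sqrt N by rewrite -sqrtr1 ler_wsqrtr//; lra.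
pose K := 10 * ln N + Z.
have K0 : 0 <= K by rewrite /K; lra.
have SK (i j : 'I_n) : i != 0%N :> nat -> `|S i j| <= K%:C.
  move=> i0; rewrite /S shifted_mx_row//.
  apply: (le_trans (ler_normB _ _)); rewrite rmorphD/=; apply: lerD; last first.
    by rewrite -ZE shift_entry_le.
  have /andP[M0 M1] := hM i j.
  have s0 : 0 <= (Num.sqrt N)^-1 by rewrite invr_ge0 sqrtr_ge0.
  rewrite ger0_norm ?ler0c ?mulr_ge0// lecR; apply: le_trans M1.
  by rewrite ler_piMl// invf_le1// (lt_le_trans ltr01).
have n0 : (0 < n)%N by exact: ltnW.
have cof i j : `|cofactor S i j| <= (N ^+ (m + 7))%:C * `|\det S|.
  have e0 : 0 < (N ^- m.+3)%:C by rewrite -[0]/(0%:C) ltcR invr_gt0.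
  have i0P (i' : 'I_n) : i' != Ordinal n0 -> i' != 0%N :> nat by [].
  have s1C : 1 <= (Num.sqrt N)%:C by rewrite -[1]/(1%:C) lecR.
  have S0 j' : S (Ordinal n0) j' = (Num.sqrt N)%:C by exact: shifted_mx_row0.
  have K0C : 0 <= K%:C by rewrite ler0c.
  have := @cofactor_le _ n S (Ordinal n0) _ K%:C _ e0 s1C K0C
    S0
    (fun i j ii => SK i j (i0P i ii)) (fun i j ii => hcof i j (i0P i ii)) i j.
  move=> /le_trans; apply; apply: ler_wpM2r => //.
  rewrite -(rmorph_nat (real_complex R)) -fmorphV -rmorphM -[1]/(1%:C).
  rewrite -rmorphM -!rmorphD lecR invrK.
  (* From [ln N <= N] and [nz0]: [K <= 10 * N + Z <= N * (10 + Z) <= N ^ 2]. *)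
  have KN : K <= N ^+ 2 by rewrite /K expr2; nra.
  have N31 : 2 + N ^+ 3 <= N ^+ 4 by rewrite [N ^+ 4]exprS exprS expr2; nra.
  rewrite (_ : (m + 7 = m.+3 + 4)%N); last by rewrite addSnnS addSnnS addSnnS.
  rewrite exprD; apply: (@le_trans _ _ (N ^+ m.+3 * (2 + N ^+ 3))); last first.
    by rewrite ler_pM2l.
  have Q1 : 1 <= N ^+ m.+3 by rewrite exprn_ege1//; lra.
  have : N * (K * N ^+ m.+3) <= N ^+ m.+3 * N ^+ 3.
    by rewrite mulrA mulrC ler_pM2l// exprS ler_pM2l.
  rewrite mulrDr -/N; lra.
apply: (smallest_singular_value_gt n0 _ _ _ dS cof).
- by rewrite exprn_ge0 ?ltW.
- by rewrite invr_gt0 exprn_gt0.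
- rewrite -/N (_ : (m + 10 = m + 7 + 3)%N); last by rewrite -addnA.
  rewrite [N ^+ (m + 7 + 3)]exprD; set L := N ^+ (m + 7).
  have L0 : L != 0 by rewrite expf_neq0// gt_eqF.
  have N00 : N != 0 by rewrite gt_eqF.
  (* The exponents add up to [2 * (m + 7) + 3 - 2 * (m + 10) = - 3]. *)
  rewrite (_ : _ * _ = (N ^+ 3)^-1); last by field; rewrite L0 N00.
  have N8 : 8 <= N ^+ 3 by rewrite !exprS expr0 mulr1; nra.
  by rewrite div1r ltf_pV2 ?posrE//; lra.
Qed.

Context d (T : measurableType d) (P : probability T R).
Context (Y : 'I_n -> 'I_n -> {RV P >-> R}).
Hypothesis iid : iid_entries Y.

(** The choice [e = n ^- (m + 3)] absorbs the losses [sqrt n <= n] and [n ^ 2 + n <= 2 * n ^ 2],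
    leaving [6 * 2 * n ^- m]. *)
Lemma probability_smallest_singular_value_le (m : nat) :
  (P [set w | smallest_singular_value (shifted_mx z0 (random_matrix Y w))
     <= n%:R ^- (m + 10)]%R <= (12 * n%:R ^- m)%:E)%E.
Proof.
have n0 : (0 < n)%N by exact: ltnW.
have N1 : 1 <= n%:R :> R by rewrite ler1n.
have N0 : 0 < n%:R :> R by rewrite ltr0n.
have e0 : 0 < n%:R ^- m.+3 :> R by rewrite invr_gt0 exprn_gt0.
apply: (@le_trans _ _ (6 * (n%:R ^- m.+3 / (Num.sqrt n%:R)^-1) *
    (n%:R ^+ 2 + n%:R))%:E); last first.
  rewrite lee_fin invrK.
  have sN : Num.sqrt n%:R <= n%:R :> R.
    rewrite -[leRHS](ger0_norm (ltW N0)) -sqrtr_sqr ler_wsqrtr//.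
    by rewrite expr2 ler_peMl// ltW.
  apply: (@le_trans _ _ (6 * (n%:R ^- m.+3 * n%:R) * (2 * n%:R ^+ 2))).
    apply: ler_pM.
    - by rewrite !mulr_ge0 ?sqrtr_ge0// ltW.
    - by rewrite addr_ge0// exprn_ge0// ltW.
    - by rewrite ler_pM2l// ler_pM2l.
    - by rewrite mulr_natl mulr2n lerD2l expr2 ler_peMl// ltW.
  rewrite le_eqVlt; apply/orP; left; apply/eqP.
  rewrite -[m.+3]addn3 exprD; field.
  by rewrite expf_neq0 ?gt_eqF.
apply: holds_up_to_le (good_event z0 n2 iid e0) _.
  apply: measurable_smallest_singular_value_le => //.
  by move=> a b; exact: random_matrix_measurable.
move=> w [range cof dS] /=; apply/negP; rewrite -ltNge.
apply: smallest_singular_value_shifted_gt => // i j.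
by rewrite mxE.
Qed.

End conclusion.

Theorem theorem5p3 (R : realType) (z0 : R[i]) (B : R) (hB : 0 < B) :
  exists A : R, 0 < A /\
  forall (d : nat -> measure_display) (T : forall n, measurableType (d n))
         (P : forall n, probability (T n) R)
         (Y : forall n, 'I_n -> 'I_n -> {RV (P n) >-> R}),
    (forall n, (2 <= n)%N -> iid_entries (Y n)) ->
    (fun n => fine (P n [set w |
       smallest_singular_value (shifted_mx z0 (random_matrix (Y n) w))
         <= n%:R `^ (- A)]))
    =O_\oo (fun n => n%:R `^ (- B)).
Proof.
(* Rounding [B] up to a natural number gives [n ^- m <= n ^ (- B)]; the exponent [A = m + 10]
   depends on [B] only. *)
pose m := Num.bound B.
have Bm : B <= m%:R by rewrite ltW// archi_boundP// ltW.
exists (m + 10)%:R; split; first by rewrite ltr0n addn_gt0 orbT.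
move=> d T P Y iid; apply/eqO_exP; exists 12 => //.
(* Only large [n] matter, so [n] may be taken beyond the threshold [10 + |z0|]. *)
near=> n.
have n2 : (2 <= n)%N by near: n; exists 2%N.
have nz0 : 10 + complex.Re `|z0| <= n%:R.
  near: n; exact: nbhs_infty_ger.
have N0 : 0 <= n%:R :> R by [].
have := probability_smallest_singular_value_le n2 nz0 (iid n n2) m.
rewrite powRN powR_mulrn// => h.
rewrite ger0_norm ?fine_ge0// ger0_norm ?powR_ge0//.
apply: (@le_trans _ _ (12 * n%:R ^- m)).
  by rewrite -lee_fin fineK// ge0_fin_numE// (le_lt_trans h)// ltry.
rewrite ler_pM2l// -powR_mulrn// -powRN; apply: ler_powR; last by rewrite lerN2.
by rewrite ler1n ltnW.
Unshelve. all: by end_near. Qed.
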